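(* Let $A$ be a finite set of positive real numbers with $|A|\geq 2$. Then $$|AA|\,|A+A|^2 \;\geq\; \frac{|A|^4}{4\lceil \log_2 |A|\rceil}.$$
   Context: For a finite set $A$ of real numbers, the sumset is $A+A=\{a+b : a,b\in A\}$ and the productset is $AA=\{ab : a,b\in A\}$. $|X|$ denotes the cardinality of a finite set $X$, and $\lceil\cdot\rceil$ is the ceiling function. *)

(* Defs.v *)
From mathcomp Require Import all_boot all_order all_algebra finmap.
From mathcomp Require Import all_classical all_reals exp.

Set Implicit Arguments.
Unset Strict Implicit.
Unset Printing Implicit Defensive.

Import Order.TTheory GRing.Theory Num.Theory.

Local Open Scope fset_scope.
Local Open Scope ring_scope.

Definition sumset (R : realType) (A : {fset R}) : {fset R} :=
  [fset a + b | a in A, b in A].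

Definition productset (R : realType) (A : {fset R}) : {fset R} :=
  [fset a * b | a in A, b in A].

Definition log2 (R : realType) (x : R) : R := ln x / ln 2.

(* Main.v *)
Require Import Defs.
From mathcomp Require Import all_boot all_order all_algebra finmap.
From mathcomp Require Import all_classical all_reals exp.
From mathcomp Require Import zify ring.

Import Order.TTheory GRing.Theory Num.Theory.

Local Open Scope fset_scope.
Local Open Scope ring_scope.

(** Write n = |A|.  The proof (Solymosi's) counts the multiplicative energy E
    of A: the number of quadruples of elements of A with a b = c d.

    Lower bound: the map (a, b) |-> a b sends n^2 pairs to |AA| values, so by
    Cauchy-Schwarz it has at least n^4 / |AA| collisions
    ([card_sqr_le_collisions]).

    Upper bound: a b = c d also reads c / a = b / d, so E counts the
    collisions of the slope map on A x A ([collisions_mul_slope]), that is,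
    E is the sum of r(s)^2, where r(s) is the number of points of A x A on the
    line of slope s through the origin.  If s < t, the r(s) r(t) sums of a point
    on the line of slope s and a point on the line of slope t are pairwise
    distinct points of (A+A) x (A+A), lying strictly between the two lines.  For
    consecutive slopes s_1 < s_2 < ... these open sectors are disjoint, so the
    sum of the products r(s_i) r(s_(i+1)) is at most |A+A|^2
    ([card_above_step]).  If moreover all r(s_i) are within a factor 2 of each
    other, then r(s_i)^2 <= 2 r(s_i) r(s_(i+1)), and the last line contributes
    at most n^2 <= |A+A|^2; hence the sum of the r(s_i)^2 is at most
    3 |A+A|^2 ([sum_sqr_line_le]).

    Since 1 <= r(s) <= n, the slopes split into the k = ceil (log2 n) classes
    [1, 2], (2, 4], ..., (2^(k-1), 2^k] according to the value of r(s), and the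
    previous bound applies to each class: E <= 3 k |A+A|^2 ([energy_le]).  The
    two bounds on E give the theorem, with 3 in place of 4. *)

(** * Fibres and collisions of a map on a finite set *)

Definition fiber {I J : choiceType} (f : I -> J) (X : {fset I}) (z : J) : {fset I} :=
  [fset x in X | f x == z].

Definition collisions {I J : choiceType} (f : I -> J) (X : {fset I}) : {fset I * I} :=
  [fset u in X `*` X | f u.1 == f u.2].

Lemma perm_fsetM {I J : choiceType} (X : {fset I}) (Y : {fset J}) :
  perm_eq (X `*` Y) [seq (x, y) | x <- X, y <- Y].
Proof.
apply: uniq_perm; rewrite ?fset_uniq ?allpairs_uniq ?fset_uniq //.
  by move=> [? ?] [? ?].
move=> [x y]; rewrite in_fsetM /=; apply/andP/allpairsP.
  by case=> xX yY; exists (x, y).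
by case=> [[x' y'] /= [xX yY [-> ->]]].
Qed.

Lemma cardfsM {I J : choiceType} (X : {fset I}) (Y : {fset J}) :
  #|` X `*` Y| = (#|` X| * #|` Y|)%N.
Proof. by rewrite (perm_size (perm_fsetM _ _)) size_allpairs. Qed.

Lemma card_fset_cond {I : choiceType} (X : {fset I}) (P : pred I) :
  #|` [fset x in X | P x]| = (\sum_(x <- X | P x) 1)%N.
Proof. by rewrite card_fset_sum1 -big_fset_condE. Qed.

Lemma sum_card_fiber {I J : choiceType} (f : I -> J) (X : {fset I}) :
  (\sum_(z <- f @` X) #|` fiber f X z| = #|` X|)%N.
Proof.
rewrite card_fset_sum1 (partition_big_imfset _ f).
by apply: eq_bigr => z _; rewrite card_fset_cond.
Qed.

(** A collision is a pair of points in a common fibre. *)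
Lemma sum_sqr_card_fiber {I J : choiceType} (f : I -> J) (X : {fset I}) :
  (\sum_(z <- f @` X) #|` fiber f X z| ^ 2 = #|` collisions f X|)%N.
Proof.
rewrite card_fset_cond [in RHS]big_mkcond (perm_big _ (perm_fsetM _ _)).
rewrite big_allpairs (partition_big_imfset _ f) /=.
apply: eq_bigr => z _; rewrite [in LHS]card_fset_cond -mulnn big_distrl /=.
apply: eq_bigr => x /eqP fxz; rewrite mul1n [in LHS]big_mkcond /=.
by apply: eq_bigr => y _; rewrite fxz eq_sym.
Qed.

(** Cauchy-Schwarz against the constant 1, in the semiring of naturals. *)
Lemma sqr_sum_le {I : Type} (s : seq I) (F : I -> nat) :
  ((\sum_(i <- s) F i) ^ 2 <= size s * \sum_(i <- s) F i ^ 2)%N.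
Proof.
elim: s => [|i s IHs]; first by rewrite !big_nil.
rewrite !big_cons sqrnD.
set S := (\sum_(j <- s) F j)%N in IHs *; set Q := (\sum_(j <- s) F j ^ 2)%N in IHs *.
suff cross : (2 * (F i * S) <= size s * F i ^ 2 + Q)%N.
  by rewrite /= mulSn mulnDr; lia.
rewrite /S /Q; elim: s {IHs S Q} => [|j s IHs]; first by rewrite !big_nil muln0.
rewrite !big_cons /=; have := (nat_Cauchy (F i) (F j)).1; lia.
Qed.

Lemma card_sqr_le_collisions {I J : choiceType} (f : I -> J) (X : {fset I}) :
  (#|` X| ^ 2 <= #|` f @` X| * #|` collisions f X|)%N.
Proof.
rewrite -sum_sqr_card_fiber -[in X in (X <= _)%N](sum_card_fiber f).
exact: sqr_sum_le.
Qed.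

(** * The multiplicative energy as a count of equal slopes *)

Definition slope {F : fieldType} (p : F * F) : F := p.2 / p.1.

(** Both sides count the multiplicative energy, since a b = c d amounts to
    c / a = b / d; exchanging coordinates between the two pairs is the
    bijection. *)
Lemma collisions_mul_slope {F : fieldType} {A : {fset F}} : 0 \notin A ->
  #|` collisions (fun p : F * F => p.1 * p.2) (A `*` A)|
    = #|` collisions slope (A `*` A)|.
Proof.
move=> A_neq0; have nz a : a \in A -> a != 0 by apply: contraTneq => ->.
pose swap (u : (F * F) * (F * F)) := ((u.1.1, u.2.1), (u.2.2, u.1.2)).
pose swap' (u : (F * F) * (F * F)) := ((u.1.1, u.2.2), (u.1.2, u.2.1)).
have swap_inj : injective swap by apply: (can_inj (g := swap')) => -[[? ?] [? ?]].
suff <- : swap @` collisions (fun p : F * F => p.1 * p.2) (A `*` A)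
    = collisions slope (A `*` A).
  by rewrite (card_imfset _ _ swap_inj).
apply/fsetP => -[[a c] [d b]]; apply/imfsetP/idP => /=.
  case=> -[[a' b'] [c' d']] /=; rewrite !inE /= -!andbA.
  case/and5P=> aA bA cA dA /eqP abcd [-> -> -> ->].
  rewrite aA bA cA dA /slope /= eqr_div ?nz // mulrC [b' * a']mulrC abcd.
  by rewrite mulrC.
rewrite !inE /= -!andbA => /and5P [aA cA dA bA].
rewrite /slope /= eqr_div ?nz // => /eqP cdba.
by exists ((a, b), (c, d)) => //; rewrite !inE /= aA bA cA dA cdba mulrC /=.
Qed.

(** * Sums of points of A x A lying on lines through the origin *)

Definition line {F : fieldType} (A : {fset F}) (s : F) : {fset F * F} :=
  fiber slope (A `*` A) s.

Definition above {R : realType} (A : {fset R}) (s : R) : {fset R * R} :=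
  [fset p in sumset A `*` sumset A | s * p.1 < p.2].

Lemma in_line {F : fieldType} {A : {fset F}} {s : F} {p : F * F} :
  0 \notin A -> p \in line A s -> [/\ p.1 \in A, p.2 \in A & p.2 = s * p.1].
Proof.
move=> A_neq0; rewrite !inE /= -andbA => /and3P [p1A p2A /eqP <-].
by rewrite /slope divfK //; apply: contraNneq A_neq0 => <-.
Qed.

Lemma card_line_le {F : fieldType} {A : {fset F}} (s : F) :
  0 \notin A -> (#|` line A s| <= #|` A|)%N.
Proof.
move=> A_neq0.
have fst_inj : {in line A s &, injective (fun p : F * F => p.1)}.
  move=> p q /(in_line A_neq0) [_ _ pE] /(in_line A_neq0) [_ _ qE].
  by move=> /= e; rewrite [p]surjective_pairing [q]surjective_pairing pE qE e.
have <- : #|` [fset p.1 | p in line A s]| = #|` line A s|.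
  exact: card_in_imfset.
apply: fsubset_leq_card.
by apply/fsubsetP => _ /imfsetP [p /(in_line A_neq0) [pA _ _] ->].
Qed.

Lemma sumset_gt0 {R : realType} {A : {fset R}} :
  (forall a, a \in A -> 0 < a) -> forall x, x \in sumset A -> 0 < x.
Proof.
by move=> A_pos x /imfset2P [a aA [b bA ->]]; rewrite addr_gt0 ?A_pos.
Qed.

Lemma card_le_sumset {R : realType} (A : {fset R}) : (#|` A| <= #|` sumset A|)%N.
Proof.
have [->|[a aA]] := fset_0Vmem A; first by rewrite cardfs0.
have <- : #|` +%R a @` A| = #|` A| by rewrite (card_imfset _ _ (addrI a)).
apply: fsubset_leq_card.
by apply/fsubsetP => _ /imfsetP [b bA ->]; apply/imfset2P; exists a => //; exists b.
Qed.

(** The sums p + q, for p on the line of slope s and q on the line of slope t,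
    lie strictly between the two lines, so they avoid the points counted above
    the line of slope t; they are pairwise distinct because directions (1, s)
    and (1, t) are linearly independent. *)
Lemma card_above_step {R : realType} {A : {fset R}} {s t : R} :
  (forall a, a \in A -> 0 < a) -> s < t ->
  (#|` line A s| * #|` line A t| + #|` above A t| <= #|` above A s|)%N.
Proof.
move=> A_pos s_lt_t; have S_pos := sumset_gt0 A_pos.
have A_neq0 : 0 \notin A by apply/negP => /A_pos; rewrite ltxx.
pose add (u : (R * R) * (R * R)) := (u.1.1 + u.2.1, u.1.2 + u.2.2).
pose B := add @` (line A s `*` line A t).
have inB x : x \in B -> exists a b,
    [/\ a \in A, s * a \in A, b \in A, t * b \in A & x = (a + b, s * a + t * b)].
  case/imfsetP => -[p q]; rewrite in_fsetM /= => /andP [].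
  move=> /(in_line A_neq0) [p1 p2 pE] /(in_line A_neq0) [q1 q2 qE] ->.
  by exists p.1, q.1; split => //; rewrite -?pE -?qE.
have <- : #|` B| = (#|` line A s| * #|` line A t|)%N.
  rewrite -cardfsM card_in_imfset //.
  move=> [[a1 a2] [b1 b2]] [[c1 c2] [d1 d2]]; rewrite !in_fsetM.
  move=> /andP [/(in_line A_neq0) /= [_ _ ->] /(in_line A_neq0) /= [_ _ ->]].
  move=> /andP [/(in_line A_neq0) /= [_ _ ->] /(in_line A_neq0) /= [_ _ ->]].
  case=> e1 e2; have bd : b1 = d1.
    (* Eliminating the first summand isolates the abscissa of the second. *)
    apply: (mulfI (x := t - s)); first by rewrite subr_eq0 gt_eqF.
    have -> : (t - s) * b1 = (s * a1 + t * b1) - s * (a1 + b1) by ring.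
    by rewrite e1 e2; ring.
  by move: e1; rewrite bd => /addIr ->.
have disj : B `&` above A t = fset0.
  apply/fsetP => x; rewrite in_fset0; apply/negP; rewrite in_fsetI => /andP [].
  move=> /inB [a [b [aA _ _ _ ->]]]; rewrite !inE /= => /andP [_].
  apply/negP; rewrite -leNgt mulrDr lerD2r ler_pM2r ?A_pos //; exact: ltW.
rewrite -cardfsUI disj cardfs0 addn0; apply: fsubset_leq_card.
apply/fsubsetP => x; rewrite in_fsetU => /orP [/inB|].
  case=> a [b [aA saA bA tbA ->]]; rewrite !inE /=; apply/andP; split.
    by apply/andP; split; apply: in_imfset2.
  by rewrite mulrDr ltrD2l ltr_pM2r ?A_pos.
rewrite !inE /= -!andbA => /and3P [x1 x2 x12]; rewrite x1 x2 /=.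
by apply: lt_trans x12; rewrite ltr_pM2r ?S_pos.
Qed.

(** Induction from the largest slope down: each r(s0)^2 is paid by the sums
    between the line of slope s0 and the next one, each r(s)^2 being at most
    twice the product of the two counts.  The last line has no successor; its
    square is absorbed by the term |A|^2. *)
Lemma sum_sqr_line_sorted {R : realType} {A : {fset R}} {s0 : R} {ss : seq R} :
  (forall a, a \in A -> 0 < a) -> path <%R s0 ss ->
  {in s0 :: ss &, forall s t, #|` line A s| <= 2 * #|` line A t|}%N ->
  (\sum_(s <- s0 :: ss) #|` line A s| ^ 2 <= 2 * #|` above A s0| + #|` A| ^ 2)%N.
Proof.
move=> A_pos; have A_neq0 : 0 \notin A by apply/negP => /A_pos; rewrite ltxx.
elim: ss s0 => [|s1 ss IHss] s0 /=.
  move=> _ _; rewrite big_seq1; apply: leq_trans (leq_addl _ _).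
  by rewrite leq_exp2r // card_line_le.
case/andP=> s01 s1ss comparable; rewrite big_cons.
have {IHss s1ss} IH := IHss s1 s1ss (fun s t ss st =>
  comparable s t (mem_behead (s := s0 :: _) ss) (mem_behead (s := s0 :: _) st)).
have r01 : (#|` line A s0| <= 2 * #|` line A s1|)%N.
  by apply: comparable; rewrite !inE eqxx ?orbT.
have step := card_above_step A_pos s01.
have r0_sqr : (#|` line A s0| ^ 2 <= 2 * (#|` line A s0| * #|` line A s1|))%N.
  by rewrite -mulnn mulnCA leq_mul2l r01 orbT.
by apply: leq_trans (leq_add r0_sqr IH) _; rewrite addnA -mulnDr leq_add2r leq_mul2l.
Qed.

Lemma sum_sqr_line_le {R : realType} {A : {fset R}} {ss : seq R} :
  (forall a, a \in A -> 0 < a) -> uniq ss ->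
  {in ss &, forall s t, #|` line A s| <= 2 * #|` line A t|}%N ->
  (\sum_(s <- ss) #|` line A s| ^ 2 <= 3 * #|` sumset A| ^ 2)%N.
Proof.
move=> A_pos ss_uniq comparable; set S2 := (_ ^ 2)%N.
have perm_ss := permEl (perm_sort <=%R ss).
rewrite -(perm_big _ perm_ss) /=.
have {comparable} : {in sort <=%R ss &, forall s t, #|` line A s| <= 2 * #|` line A t|}%N.
  by move=> s t; rewrite !mem_sort; apply: comparable.
have : sorted <%R (sort <=%R ss) by rewrite sort_lt_sorted.
case: (sort _ _) => [|s0 {perm_ss ss_uniq}ss]; first by rewrite big_nil.
move=> /(sum_sqr_line_sorted A_pos) le_sum /le_sum /leq_trans; apply.
rewrite -[3%N]/(2 + 1)%N mulnDl mul1n leq_add ?leq_exp2r ?card_le_sumset //.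
rewrite leq_mul2l /= /S2 -mulnn -cardfsM fsubset_leq_card //.
by apply/fsubsetP => p; rewrite !inE => /andP [].
Qed.

(** * Dyadic decomposition of the energy *)

(** The predecessor merges the value 1 into the class of 2: values up to
    2^k, with k positive, then fall into exactly k dyadic classes. *)
Lemma up_log2_pred_bounds {n : nat} :
  (0 < n)%N -> (2 ^ (up_log 2 n).-1 <= n <= 2 * 2 ^ (up_log 2 n).-1)%N.
Proof.
case: n => [|[|n]] // _.
have /andP [lo hi] := @up_log_bounds 2 n.+2 isT isT.
by rewrite (ltnW lo) -expnS prednK // up_log_gt0.
Qed.

(** The slopes are grouped by the dyadic size of their line; two lines of the
    same class have sizes within a factor 2, so each of the k + 1 classes
    contributes at most 3 |A+A|^2. *)
Lemma energy_le {R : realType} {A : {fset R}} {k : nat} :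
  (forall a, a \in A -> 0 < a) -> (#|` A| <= 2 ^ k.+1)%N ->
  (#|` collisions slope (A `*` A)| <= k.+1 * (3 * #|` sumset A| ^ 2))%N.
Proof.
move=> A_pos A_le; rewrite -sum_sqr_card_fiber -/(line A _).
have A_neq0 : 0 \notin A by apply/negP => /A_pos; rewrite ltxx.
set Q := slope @` _.
pose cls s := (up_log 2 #|` line A s|).-1.
have line_gt0 s : s \in Q -> (0 < #|` line A s|)%N.
  case/imfsetP => p pA ->; rewrite cardfs_gt0; apply/fset0Pn; exists p.
  by rewrite !inE eqxx andbT; move: pA; rewrite !inE.
have cls_lt s : (cls s < k.+1)%N.
  have := @up_log_min 2 _ _ isT (leq_trans (card_line_le s A_neq0) A_le).
  by rewrite /cls; lia.
rewrite (partition_big (fun s => Ordinal (cls_lt s)) predT) //=.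
rewrite -[k.+1 in leqRHS]card_ord -sum_nat_const; apply: leq_sum => i _.
rewrite -big_filter; apply: sum_sqr_line_le => //.
  by rewrite filter_uniq ?fset_uniq.
move=> s t; rewrite !mem_filter => /andP [/eqP si sQ] /andP [/eqP ti tQ].
have /andP [_ s_hi] := up_log2_pred_bounds (line_gt0 s sQ).
have /andP [t_lo _] := up_log2_pred_bounds (line_gt0 t tQ).
apply: leq_trans s_hi _; rewrite leq_mul2l /=.
by move: (congr1 val si) (congr1 val ti); rewrite /= /cls => -> <-.
Qed.

(** * Conclusion *)

Lemma card_pow4_le {R : realType} {A : {fset R}} {k : nat} :
  (forall a, a \in A -> 0 < a) -> (#|` A| <= 2 ^ k.+1)%N ->
  (#|` A| ^ 4 <= #|` productset A| * (k.+1 * (3 * #|` sumset A| ^ 2)))%N.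
Proof.
move=> A_pos A_le.
have A_neq0 : 0 \notin A by apply/negP => /A_pos; rewrite ltxx.
have := card_sqr_le_collisions (fun p : R * R => p.1 * p.2) (A `*` A).
rewrite cardfsM mulnn -expnM collisions_mul_slope // => le_coll.
apply: leq_trans le_coll _.
apply: leq_mul; last exact: energy_le.
apply: fsubset_leq_card; apply/fsubsetP => _ /imfsetP [[a b] /= abA ->].
move: abA; rewrite in_fsetM => /andP [aA bA].
by apply/imfset2P; exists a => //; exists b.
Qed.

(** For n at least 2 the ceiling is positive, hence a successor, which is the
    form in which the number of dyadic classes is used. *)
Lemma ceil_log2_spec (R : realType) {n : nat} : (2 <= n)%N ->
  exists2 k : nat, Num.ceil (log2 (n%:R : R)) = k.+1%:Z & (n <= 2 ^ k.+1)%N.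
Proof.
move=> n_ge2; have n_gt0 : 0 < n%:R :> R by rewrite ltr0n; lia.
have ln2_gt0 : 0 < ln (2 : R) by rewrite ln_gt0 // ltr1n.
have log_gt0 : 0 < log2 (n%:R : R) by rewrite divr_gt0 // ln_gt0 // ltr1n.
have log_le := Num.Theory.ceil_ge (log2 (n%:R : R)).
have : 0 < Num.ceil (log2 (n%:R : R)) by rewrite ceil_gt0.
case: (Num.ceil _) log_le => [[|k]|] // log_le _; exists k => //.
rewrite -(ler_nat R) natrX -ler_ln ?posrE ?exprn_gt0 //.
by rewrite lnXn // -[leRHS]mulr_natl -ler_pdivrMr.
Qed.

Theorem theorem2p1 (R : realType) (A : {fset R})
    (A_pos : forall a : R, a \in A -> 0 < a)
    (A_ge2 : (2 <= #|` A|)%N) :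
  (#|` productset A|)%:R * (#|` sumset A|)%:R ^+ 2
    >= (#|` A|)%:R ^+ 4 / (4 * (Num.ceil (log2 (#|` A|%:R : R)))%:~R) :> R.
Proof.
have [k -> A_le] := ceil_log2_spec R A_ge2.
rewrite ler_pdivrMr ?mulr_gt0 ?ltr0n //.
rewrite -[_%:~R]/(k.+1%:R) -!natrX -!natrM ler_nat.
apply: leq_trans (card_pow4_le A_pos A_le) _.
by rewrite -mulnA leq_mul2l; apply/orP; right; lia.
Qed.
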